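(* Let $G$ be a finite group and $S$ one of the Fischer groups $Fi_{22}, Fi_{23}, Fi_{24}'$. If $|G| = |S|$, then $G$ is neither a Frobenius group nor a 2-Frobenius group.
   Context: A finite group $G$ is a 2-Frobenius group if it has a normal series $1 \trianglelefteq A \trianglelefteq B \trianglelefteq G$ such that $B$ is a Frobenius group with Frobenius kernel $A$ and $G/A$ is a Frobenius group with Frobenius kernel $B/A$. Orders: $|Fi_{22}|=2^{17}\cdot3^9\cdot5^2\cdot7\cdot11\cdot13$, $|Fi_{23}|=2^{18}\cdot3^{13}\cdot5^2\cdot7\cdot11\cdot13\cdot17\cdot23$, $|Fi_{24}'|=2^{21}\cdot3^{16}\cdot5^2\cdot7^3\cdot11\cdot13\cdot17\cdot23\cdot29$. *)

(* Defs.v *)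
From mathcomp Require Import all_boot all_fingroup all_solvable.
Set Implicit Arguments. Unset Strict Implicit. Unset Printing Implicit Defensive.
Local Open Scope group_scope.

Definition two_Frobenius (gT : finGroupType) (G : {group gT}) : Prop :=
  exists (A B : {group gT}),
    [/\ A <| G, A <| B, B <| G,
        [Frobenius B with kernel A]
      & [Frobenius (G / A) with kernel (B / A)]].

Definition order_Fi22 : nat := (2^17 * 3^9 * 5^2 * 7 * 11 * 13)%N.
Definition order_Fi23 : nat := (2^18 * 3^13 * 5^2 * 7 * 11 * 13 * 17 * 23)%N.
Definition order_Fi24' : nat := (2^21 * 3^16 * 5^2 * 7^3 * 11 * 13 * 17 * 23 * 29)%N.

(* Main.v *)
Require Import Defs.
From mathcomp Require Import all_boot all_fingroup all_solvable.
From mathcomp Require Import vcharacter.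
Set Implicit Arguments. Unset Strict Implicit. Unset Printing Implicit Defensive.

(* Group theory enters through a single arithmetic fact: if X is Frobenius with
   kernel K, then k = |K| and h = |X : K| satisfy
     1 < k, 1 < h, coprime k h, and h divides k_p - 1 for every p-part k_p of k
   (a complement can be chosen to normalize a Sylow p-subgroup P of K, and then
   P <*> H is again Frobenius with kernel P).  Call such (k, h) a Frobenius pair.
   A Frobenius group of order N yields a Frobenius pair with k * h = N; a
   2-Frobenius group yields pairs (a, b) and (b, c) with a * b * c = N.

   The rest is arithmetic.  For a prime t dividing N exactly once, and an
   auxiliary prime u, a handful of congruence conditions on the prime-power parts
   of N (record obstruction) rule out both factorization patterns: a case split
   on which factor t divides leads each time to some N_p or p^j that would have to
   be 1 modulo t, or modulo N_u, or to divide t - 1.  For the three Fischer group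
   orders these conditions are checked by computation on the factorization
   (with t = 7, 13, 13 and u = 5, 5, 7). *)

Lemma prime_dvd_coprime p m n :
  prime p -> coprime m n -> p %| m -> p %| n -> False.
Proof.
by move=> pr_p co_mn p_m p_n; have := coprime_dvdl p_m co_mn; rewrite prime_coprime ?p_n.
Qed.

Lemma pred_prime_gt0 p : prime p -> 0 < p.-1.
Proof. by move=> pr_p; rewrite -subn1 subn_gt0 prime_gt1. Qed.

Lemma prime_notdvd_pred p : prime p -> ~~ (p %| p.-1).
Proof.
move=> pr_p; apply/negP => /(dvdn_leq (pred_prime_gt0 pr_p)).
by rewrite leqNgt ltn_predL prime_gt0.
Qed.

Lemma partn_coprimeMr d e p :
  prime p -> coprime d e -> p %| d -> 0 < d * e -> (d * e)`_p = d`_p.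
Proof.
move=> pr_p co_de p_d; rewrite muln_gt0 => /andP[d_gt0 e_gt0].
suff e_p : e`_p = 1 by rewrite partnM // e_p muln1.
rewrite p_part; apply/eqP; rewrite -(expn0 p) eqn_exp2l ?prime_gt1 //.
rewrite -leqn0 leqNgt logn_gt0 mem_primes pr_p e_gt0 /=.
by apply/negP => p_e; apply: (prime_dvd_coprime pr_p co_de).
Qed.

Lemma part_pred_notdvd N d p m :
  0 < N -> d %| N -> prime p -> p %| d ->
  (forall j, 0 < j <= logn p N -> ~~ (m %| (p ^ j).-1)) -> ~~ (m %| (d`_p).-1).
Proof.
move=> N_gt0 d_N pr_p p_d notdvd; rewrite p_part; apply: notdvd.
have d_gt0 := dvdn_gt0 N_gt0 d_N.
by rewrite logn_gt0 mem_primes pr_p d_gt0 p_d dvdn_leq_log.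
Qed.

(* (k, h) are the kernel order and complement order of a Frobenius group. *)
Definition Frobenius_pair (k h : nat) : Prop :=
  [/\ 1 < k, 1 < h, coprime k h & forall p : nat, h %| (k`_p).-1].

Record obstruction (N t u : nat) : Prop := Obstruction {
  obs_t_prime : prime t;
  obs_t_part : N`_t = t;
  obs_t_notdvd : forall p, prime p -> p %| N -> p != t -> ~~ (t %| (N`_p).-1);
  obs_part_notdvd : forall p, prime p -> p %| N -> p != t -> ~~ (N`_p %| t.-1);
  obs_u_prime : prime u;
  obs_u_dvd : u %| N;
  obs_u_notdvd : ~~ (u %| t.-1);
  obs_u_order : forall j, 0 < j <= logn u N -> ~~ (t %| (u ^ j).-1);
  obs_u_part : forall p, prime p -> p %| N -> p != u ->
    forall j, 0 < j <= logn p N -> ~~ (N`_u %| (p ^ j).-1)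
}.

Section FrobeniusPairs.

Variables N t u : nat.
Hypothesis obs : obstruction N t u.

Let pr_t := obs_t_prime obs.

Lemma obstruction_gt0 : 0 < N.
Proof.
have := obs_t_part obs; have [-> | //] := posnP N.
by rewrite partn0 => t1; have := prime_gt1 pr_t; rewrite -t1.
Qed.

(* Since t divides N exactly once, every divisor of N divisible by t has t-part t. *)
Lemma t_part_dvd d : d %| N -> t %| d -> d`_t = t.
Proof.
move=> d_N t_d; apply/eqP; rewrite eqn_dvd; apply/andP; split.
  by rewrite -{2}(obs_t_part obs) partn_dvd ?obstruction_gt0.
rewrite -{1}(part_pnat_id (pnat_id pr_t)) partn_dvd //.
exact: dvdn_gt0 obstruction_gt0 d_N.
Qed.

(* t cannot divide the complement part h when the kernel part k is a Hall
   divisor of N: a prime p of k would give N_p = 1 modulo t. *)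
Lemma t_notdvd_complement k h e :
  k * e = N -> coprime k e -> h %| e -> 1 < k -> t %| h ->
  (forall p : nat, h %| (k`_p).-1) -> False.
Proof.
move=> def_N co_ke h_e k_gt1 t_h h_kp; set p := pdiv k.
have pr_p : prime p := pdiv_prime k_gt1.
have p_k : p %| k := pdiv_dvd k.
have p_N : p %| N by rewrite -def_N dvdn_mulr.
have p_neq_t : p != t.
  apply/eqP => def_p; apply: (prime_dvd_coprime pr_t co_ke).
    by rewrite -def_p.
  exact: dvdn_trans t_h h_e.
have N_p : N`_p = k`_p by rewrite -def_N partn_coprimeMr // def_N obstruction_gt0.
have /negP[] := obs_t_notdvd obs pr_p p_N p_neq_t.
by rewrite N_p (dvdn_trans t_h (h_kp p)).
Qed.

(* t cannot divide the kernel part k when the complement part h is a Hall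
   divisor of N: then h divides t - 1, so some N_q divides t - 1. *)
Lemma t_notdvd_kernel k h e :
  k %| N -> h * e = N -> coprime h e -> 1 < h -> t %| k ->
  (forall p : nat, h %| (k`_p).-1) -> False.
Proof.
move=> k_N def_N co_he h_gt1 t_k h_kp; set q := pdiv h.
have h_t1 : h %| t.-1 by rewrite -(t_part_dvd k_N t_k) h_kp.
have pr_q : prime q := pdiv_prime h_gt1.
have q_h : q %| h := pdiv_dvd h.
have q_N : q %| N by rewrite -def_N dvdn_mulr.
have q_neq_t : q != t.
  apply: contraNneq (prime_notdvd_pred pr_t) => def_q.
  by rewrite -{1}def_q (dvdn_trans q_h h_t1).
have /negP[] := obs_part_notdvd obs pr_q q_N q_neq_t.
rewrite -def_N partn_coprimeMr ?def_N ?obstruction_gt0 //.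
exact: dvdn_trans (dvdn_part _ _) h_t1.
Qed.

Lemma no_Frobenius_pair k h : k * h = N -> ~ Frobenius_pair k h.
Proof.
move=> def_N [k_gt1 h_gt1 co_kh h_kp].
have : t %| k * h by rewrite def_N -(obs_t_part obs) dvdn_part.
rewrite Euclid_dvdM // => /orP[t_k | t_h].
  have k_N : k %| N by rewrite -def_N dvdn_mulr.
  have def_N' : h * k = N by rewrite mulnC.
  have co_hk : coprime h k by rewrite coprime_sym.
  exact: t_notdvd_kernel k_N def_N' co_hk h_gt1 t_k h_kp.
exact: t_notdvd_complement def_N co_kh (dvdnn h) k_gt1 t_h h_kp.
Qed.

(* In the middle case t | b of a 2-Frobenius pattern, c divides t - 1, and the
   auxiliary prime u is forced into b: it cannot lie in a (t would divide some
   u^j - 1) nor in c (u would divide t - 1). *)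
Lemma u_dvd_middle a b c :
  a * b * c = N -> coprime a b -> t %| b -> (forall p : nat, b %| (a`_p).-1) ->
  c %| t.-1 -> u %| b.
Proof.
move=> def_N co_ab t_b b_ap c_t1; have pr_u := obs_u_prime obs.
have : u %| a * b * c by rewrite def_N (obs_u_dvd obs).
rewrite !Euclid_dvdM // => /orP[/orP[u_a | //] | u_c].
  have a_N : a %| N by rewrite -def_N -mulnA dvdn_mulr.
  have /negP[] := part_pred_notdvd obstruction_gt0 a_N pr_u u_a (obs_u_order obs).
  exact: dvdn_trans t_b (b_ap u).
by have /negP[] := obs_u_notdvd obs; apply: dvdn_trans u_c c_t1.
Qed.

(* Hence N_u divides b and so a_r - 1 for the smallest prime r of a, which
   the last condition of the obstruction excludes. *)
Lemma t_notdvd_middle a b c :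
  a * b * c = N -> Frobenius_pair a b -> Frobenius_pair b c -> t %| b -> False.
Proof.
move=> def_N [a_gt1 _ co_ab b_ap] [_ _ co_bc c_bq] t_b.
have b_N : b %| N by rewrite -def_N (mulnC a) -mulnA dvdn_mulr.
have c_t1 : c %| t.-1 by rewrite -(t_part_dvd b_N t_b) c_bq.
have u_b := u_dvd_middle def_N co_ab t_b b_ap c_t1.
have pr_u := obs_u_prime obs.
have co_bac : coprime b (a * c) by rewrite coprimeMr coprime_sym co_ab.
have def_N' : b * (a * c) = N by rewrite -def_N mulnA (mulnC b).
have N_u_b : N`_u %| b.
  by rewrite -def_N' partn_coprimeMr ?def_N' ?obstruction_gt0 ?dvdn_part.
set r := pdiv a; have pr_r : prime r := pdiv_prime a_gt1.
have r_a : r %| a := pdiv_dvd a.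
have a_N : a %| N by rewrite -def_N -mulnA dvdn_mulr.
have r_neq_u : r != u.
  by apply/eqP => def_r; apply: (prime_dvd_coprime pr_u co_ab _ u_b); rewrite -def_r.
have := part_pred_notdvd obstruction_gt0 a_N pr_r r_a.
move/(_ _ (obs_u_part obs pr_r (dvdn_trans r_a a_N) r_neq_u))/negP; apply.
exact: dvdn_trans N_u_b (b_ap r).
Qed.

Lemma no_Frobenius_pairs a b c :
  a * b * c = N -> Frobenius_pair a b -> Frobenius_pair b c -> False.
Proof.
move=> def_N ab_pair bc_pair; have [a_gt1 b_gt1 co_ab b_ap] := ab_pair.
have [_ _ co_bc c_bq] := bc_pair.
have co_bac : coprime b (a * c) by rewrite coprimeMr coprime_sym co_ab.
have def_N' : b * (a * c) = N by rewrite -def_N mulnA (mulnC b).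
have : t %| a * b * c by rewrite def_N -(obs_t_part obs) dvdn_part.
rewrite !Euclid_dvdM // => /orP[/orP[t_a | t_b] | t_c].
- have a_N : a %| N by rewrite -def_N -mulnA dvdn_mulr.
  exact: t_notdvd_kernel a_N def_N' co_bac b_gt1 t_a b_ap.
- exact: t_notdvd_middle def_N ab_pair bc_pair t_b.
- exact: t_notdvd_complement def_N' co_bac (dvdn_mull a (dvdnn c)) b_gt1 t_c c_bq.
Qed.

End FrobeniusPairs.

Section FrobeniusOrders.

Local Open Scope group_scope.
Variable gT : finGroupType.
Implicit Types X K P : {group gT}.

(* Frattini argument + Schur-Zassenhaus in N_X(P): some complement of the
   Frobenius kernel K normalizes a given Sylow subgroup P of K. *)
Lemma Frobenius_compl_norm_Sylow X K P p :
  [Frobenius X with kernel K] -> p.-Sylow(K) P ->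
  exists2 H : {group gT}, [Frobenius X = K ><| H] & H \subset 'N(P).
Proof.
move=> frobX sylP; have /Frobenius_kerP[_ _ nsKX _] := frobX.
have [_ nKX] := andP nsKX.
set M := 'N_X(P)%G.
have defX : K * M = X := Frattini_arg nsKX sylP.
have nsMK_M : M :&: K <| M := normalGI (subsetIl _ _) nsKX.
have hallMK : Hall M (M :&: K).
  rewrite /Hall subsetIl indexgI -indexMg defX.
  exact: coprimeSg (subsetIr _ _) (Frobenius_ker_coprime frobX).
have [H /complP[tiMKH defM]] := splitsP (SchurZassenhaus_split hallMK nsMK_M).
have sHM : H \subset M by rewrite -defM mulG_subr.
exists H; last exact: subset_trans sHM (subsetIr _ _).
apply: set_Frobenius_compl frobX.
have tiKH : K :&: H = 1 by rewrite -(setIidPr sHM) setIA (setIC K).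
rewrite sdprodE ?(subset_trans (subset_trans sHM (subsetIl _ _)) nKX) //.
by rewrite -[RHS]defX -defM mulgA (mulGSid (subsetIr M K)).
Qed.

(* The complement order divides p_part - 1: with H normalizing the Sylow
   subgroup P of K, P <*> H is Frobenius with kernel P and complement H. *)
Lemma Frobenius_index_dvd_part_pred X K (p : nat) :
  [Frobenius X with kernel K] -> (#|X : K| %| (#|K|`_p).-1)%N.
Proof.
move=> frobX; have [P sylP] := Sylow_exists p K.
have [H frobXH nPH] := Frobenius_compl_norm_Sylow frobX sylP.
have [defX _ _ _ _] := Frobenius_context frobXH.
rewrite -(index_sdprod defX) -(card_Hall sylP).
have [trivP | ntP] := eqsVneq P 1; first by rewrite trivP cards1 dvdn0.
exact: Frobenius_dvd_ker1 (Frobenius_subl ntP (pHall_sub sylP) nPH frobXH).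
Qed.

Lemma Frobenius_kernel_pair X K :
  [Frobenius X with kernel K] ->
  (#|K| * #|X : K|)%N = #|X| /\ Frobenius_pair #|K| #|X : K|.
Proof.
move=> frobX; have /Frobenius_kerP[ntK ltKX _ _] := frobX.
split; first by rewrite Lagrange ?proper_sub.
split; first by rewrite cardG_gt1.
- by rewrite indexg_gt1 proper_subn.
- exact: Frobenius_ker_coprime frobX.
- by move=> p; apply: Frobenius_index_dvd_part_pred.
Qed.

End FrobeniusOrders.

(* Numbers given by a prime factorization, a list of (prime, exponent) pairs;
   the exponent of p is read off the list without any duplicate-free assumption. *)
Definition fvalue (F : seq (nat * nat)) : nat := foldr (fun f n => n * f.1 ^ f.2) 1 F.
Definition fexponent (F : seq (nat * nat)) (p : nat) : nat :=
  foldr (fun f n => n + (f.1 == p) * f.2) 0 F.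

Lemma fvalue_gt0 F : all [pred f | prime f.1] F -> 0 < fvalue F.
Proof.
elim: F => //= f F IH /andP[pr_f /IH F_gt0].
by rewrite muln_gt0 F_gt0 expn_gt0 prime_gt0.
Qed.

Lemma logn_fvalue F p :
  all [pred f | prime f.1] F -> prime p -> logn p (fvalue F) = fexponent F p.
Proof.
move=> primeF pr_p; elim: F primeF => [|f F IH] /=; first by rewrite logn1.
case/andP=> pr_f primeF; rewrite -/(fvalue F) -/(fexponent F p).
rewrite lognM ?fvalue_gt0 ?expn_gt0 ?prime_gt0 // IH // lognX logn_prime //.
by rewrite mulnC eq_sym.
Qed.

Lemma fexponent_gt0 F p : 0 < fexponent F p -> p \in map fst F.
Proof.
elim: F => //= f F IH; rewrite inE addn_gt0 => /orP[/IH -> |]; first by rewrite orbT.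
by case: eqP => [-> | //]; rewrite eqxx.
Qed.

(* p ^ j modulo m, computed with small intermediate values. *)
Definition pow_mod (m p j : nat) : nat := iter j (fun y => y * p %% m) (1 %% m).

Lemma pow_modE m p j : pow_mod m p j = p ^ j %% m.
Proof.
elim: j => [|j IH] //=; rewrite /pow_mod /= -/(pow_mod m p j) IH.
by rewrite modnMml expnSr.
Qed.

Lemma dvd_pred_pow m p j : 0 < p -> (m %| (p ^ j).-1) = (pow_mod m p j == 1 %% m).
Proof. by move=> p_gt0; rewrite pow_modE -subn1 -eqn_mod_dvd // expn_gt0 p_gt0. Qed.

Definition pow_pred_free (m p e : nat) : bool :=
  all (fun j => pow_mod m p j != 1 %% m) (iota 1 e).

Lemma pow_pred_freeP m p e j :
  0 < p -> pow_pred_free m p e -> 0 < j <= e -> ~~ (m %| (p ^ j).-1).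
Proof.
move=> p_gt0 /allP free_p /andP[j_gt0 j_le_e]; rewrite dvd_pred_pow //.
by apply: free_p; rewrite mem_iota j_gt0 add1n ltnS.
Qed.

Definition certificate (F : seq (nat * nat)) (t u : nat) : bool :=
  let e := fexponent F in
  [&& all [pred f | prime f.1] F, prime t, e t == 1, 0 < e u, ~~ (u %| t.-1),
      pow_pred_free t u (e u),
      all [pred p | (p != t) ==> (pow_mod t p (e p) != 1 %% t) && (logn p t.-1 < e p)]
          (map fst F)
    & all [pred p | (p != u) ==> pow_pred_free (u ^ e u) p (e p)] (map fst F)].

Lemma certificate_obstruction F t u : certificate F t u -> obstruction (fvalue F) t u.
Proof.
case/and5P=> primeF pr_t e_t e_u /and4P[u_t1 u_free t_cond u_cond].
set N := fvalue F; have N_gt0 : 0 < N := fvalue_gt0 primeF.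
have logN p : prime p -> logn p N = fexponent F p by move/(logn_fvalue primeF).
have partN p : prime p -> N`_p = p ^ fexponent F p by move=> pr_p; rewrite p_part logN.
have inF p : prime p -> p %| N -> p \in map fst F.
  by move=> pr_p p_N; rewrite fexponent_gt0 // -logN // logn_gt0 mem_primes pr_p N_gt0.
have u_inF := fexponent_gt0 e_u.
have pr_u : prime u by have /mapP[f /(allP primeF) pr_f ->] := u_inF.
split=> //.
- by rewrite partN // (eqP e_t) expn1.
- move=> p pr_p p_N p_t; have := allP t_cond p (inF p pr_p p_N).
  by rewrite /= p_t partN // dvd_pred_pow ?prime_gt0 // => /andP[].
- move=> p pr_p p_N p_t; have := allP t_cond p (inF p pr_p p_N).
  by rewrite /= p_t partN // pfactor_dvdn ?pred_prime_gt0 // -ltnNge => /andP[].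
- by rewrite -(expn1 u) pfactor_dvdn // logN.
- by move=> j; rewrite logN //; apply: pow_pred_freeP (prime_gt0 pr_u) u_free.
- move=> p pr_p p_N p_u j; rewrite logN // partN //.
  apply: pow_pred_freeP (prime_gt0 pr_p) _.
  by have := allP u_cond p (inF p pr_p p_N); rewrite /= p_u.
Qed.

Definition factorization_Fi22 : seq (nat * nat) :=
  [:: (13, 1); (11, 1); (7, 1); (5, 2); (3, 9); (2, 17)].
Definition factorization_Fi23 : seq (nat * nat) :=
  [:: (23, 1); (17, 1); (13, 1); (11, 1); (7, 1); (5, 2); (3, 13); (2, 18)].
Definition factorization_Fi24' : seq (nat * nat) :=
  [:: (29, 1); (23, 1); (17, 1); (13, 1); (11, 1); (7, 3); (5, 2); (3, 16); (2, 21)].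

(* Unfolding fvalue reproduces the frozen orders syntactically, so that no
   large number is ever computed. *)
Lemma fvalue_Fi22 : fvalue factorization_Fi22 = order_Fi22.
Proof. by rewrite /fvalue /order_Fi22 /= !expn1 (mul1n (2 ^ 17)). Qed.

Lemma fvalue_Fi23 : fvalue factorization_Fi23 = order_Fi23.
Proof. by rewrite /fvalue /order_Fi23 /= !expn1 (mul1n (2 ^ 18)). Qed.

Lemma fvalue_Fi24' : fvalue factorization_Fi24' = order_Fi24'.
Proof. by rewrite /fvalue /order_Fi24' /= !expn1 (mul1n (2 ^ 21)). Qed.

Lemma Fischer_order_obstruction N :
  N \in [:: order_Fi22; order_Fi23; order_Fi24'] -> exists t u, obstruction N t u.
Proof.
rewrite !inE => /or3P[] /eqP->.
- by exists 7, 5; rewrite -fvalue_Fi22; apply: certificate_obstruction; vm_compute.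
- by exists 13, 5; rewrite -fvalue_Fi23; apply: certificate_obstruction; vm_compute.
- by exists 13, 7; rewrite -fvalue_Fi24'; apply: certificate_obstruction; vm_compute.
Qed.

Local Open Scope group_scope.

Theorem lemma2p11 (gT : finGroupType) (G : {group gT}) :
  #|G| \in [:: order_Fi22; order_Fi23; order_Fi24'] ->
  ~ [Frobenius G] /\ ~ two_Frobenius G.
Proof.
move=> /Fischer_order_obstruction[t [u obs]]; split.
  case/existsP=> H /Frobenius_kernel_exists[K /FrobeniusWker frobK].
  have [oG pairK] := Frobenius_kernel_pair frobK.
  exact: (no_Frobenius_pair obs oG pairK).
case=> A [B [nsAG nsAB nsBG frobB frobGA]].
have [oB pairA] := Frobenius_kernel_pair frobB.
have [_ pairBA] := Frobenius_kernel_pair frobGA.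
have [sAB sBG] := (normal_sub nsAB, normal_sub nsBG).
rewrite card_quotient ?normal_norm // index_quotient_eq ?normal_norm
  ?subIset ?sAB ?orbT // in pairBA.
apply: (no_Frobenius_pairs obs _ pairA pairBA).
by rewrite oB Lagrange.
Qed.
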